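(* Let $n \geq 3$. Let $G \colon \mathbf{Cstar}^{\mathrm{op}} \to \mathbf{Top}$ be any functor that assigns to each commutative C*-algebra its Gelfand spectrum, i.e. the restriction of $G$ to $\mathbf{cCstar}^{\mathrm{op}}$ is the Gelfand spectrum functor $\mathrm{Spec} \colon \mathbf{cCstar}^{\mathrm{op}} \to \mathbf{Top}$ (up to natural isomorphism). Then $G$ trivializes on the C*-algebra $\mathbb{M}_n(\mathbb{C})$ of $n$-by-$n$ complex matrices: $G(\mathbb{M}_n(\mathbb{C}))$ is the initial object of $\mathbf{Top}$, the empty topological space.
   Context: All C*-algebras are unital (the zero algebra, in which $0=1$, is allowed). $\mathbf{Cstar}$ is the category of C*-algebras and unital $*$-homomorphisms, and $\mathbf{cCstar}$ is its full subcategory of commutative C*-algebras. $\mathbf{Top}$ is the category of topological spaces and continuous functions. The Gelfand spectrum of a commutative C*-algebra $A$ is the compact Hausdorff space $\mathrm{Spec}(A)$ of characters (unital $*$-homomorphisms $A \to \mathbb{C}$) of $A$ with the topology of pointwise convergence. A unital $*$-homomorphism $A \to B$ induces, by precomposition, a continuous function $\mathrm{Spec}(B) \to \mathrm{Spec}(A)$. *)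

(* Defs.v *)
From HB Require Import structures.
From mathcomp Require Import all_boot all_order all_algebra.
From mathcomp Require Import all_classical all_reals all_analysis.
From mathcomp Require Import complex ring.

Set Implicit Arguments.
Unset Strict Implicit.
Unset Printing Implicit Defensive.

Import Order.TTheory GRing.Theory Num.Theory.
Import numFieldNormedType.Exports.

Local Open Scope classical_set_scope.
Local Open Scope ring_scope.

Record category := Category {
  obj :> Type;
  arrow : obj -> obj -> Type;
  idc : forall a, arrow a a;
  compc : forall a b c, arrow b c -> arrow a b -> arrow a c;
  compc1 : forall a b (f : arrow a b), compc f (idc a) = f;
  comp1c : forall a b (f : arrow a b), compc (idc b) f = f;
  compcA : forall a b c d (h : arrow c d) (g : arrow b c) (f : arrow a b),
    compc h (compc g f) = compc (compc h g) f
}.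
Arguments arrow {C} a b : rename.
Arguments idc {C} a : rename.
Arguments compc {C a b c} g f : rename.

Definition op (C : category) : category :=
  @Category C (fun a b => @arrow C b a) (@idc C) (fun _ _ _ g f => compc f g)
    (fun _ _ f => comp1c f) (fun _ _ f => compc1 f)
    (fun _ _ _ _ h g f => esym (compcA f g h)).

Definition full_subcategory (C : category) (P : C -> Prop) : category :=
  @Category {a : C | P a} (fun a b => arrow (sval a) (sval b))
    (fun a => idc (sval a)) (fun _ _ _ g f => compc g f)
    (fun _ _ f => compc1 f) (fun _ _ f => comp1c f)
    (fun _ _ _ _ h g f => compcA h g f).

Record functor (C D : category) := Functor {
  fobj :> C -> D;
  fmap : forall a b : C, arrow a b -> arrow (fobj a) (fobj b);
  fmap1 : forall a : C, fmap (idc a) = idc (fobj a);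
  fmapM : forall (a b c : C) (g : arrow b c) (f : arrow a b),
    fmap (compc g f) = compc (fmap g) (fmap f)
}.
Arguments fmap {C D} f {a b} _ : rename.

Definition inclusion (C : category) (P : C -> Prop) :
    functor (full_subcategory P) C :=
  @Functor (full_subcategory P) C (fun a => sval a) (fun _ _ f => f)
    (fun _ => erefl) (fun _ _ _ _ _ => erefl).

Definition op_functor (C D : category) (F : functor C D) :
    functor (op C) (op D) :=
  @Functor (op C) (op D) F (fun a b (f : @arrow C b a) => fmap F f)
    (fmap1 F) (fun _ _ _ g f => fmapM F f g).

Program Definition comp_functor (C D E : category)
    (G : functor D E) (F : functor C D) : functor C E :=
  @Functor C E (fun a => G (F a)) (fun a b f => fmap G (fmap F f)) _ _.
Next Obligation. by move=> C D E G F a /=; rewrite !fmap1. Qed.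
Next Obligation. by move=> C D E G F a b c g f /=; rewrite !fmapM. Qed.

Definition is_iso (C : category) (a b : C) (f : arrow a b) : Prop :=
  exists g : arrow b a, compc g f = idc a /\ compc f g = idc b.

Definition naturally_isomorphic (C D : category) (F G : functor C D) : Prop :=
  exists eta : forall a : C, arrow (F a) (G a),
    (forall a, is_iso (eta a)) /\
    (forall (a b : C) (f : arrow a b),
       compc (eta b) (fmap F f) = compc (fmap G f) (eta a)).

Definition is_initial (C : category) (a : C) : Prop :=
  forall b : C, exists f : arrow a b, forall g : arrow a b, g = f.

Program Definition Top : category :=
  @Category topologicalType (fun X Y => continuousType X Y)
    (fun X => idfun) (fun X Y Z g f => g \o f) _ _ _.
Next Obligation. by move=> X Y f; apply/continuousEP. Qed.
Next Obligation. by move=> X Y f; apply/continuousEP. Qed.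
Next Obligation. by move=> X Y Z T h g f; apply/continuousEP. Qed.

(* The algebra structure is listed in full because [algType] excludes the zero
   algebra. Over the field [R[i]], norms take their values in the nonnegative
   elements of [R[i]], that is, in the nonnegative reals. [k^*] is complex
   conjugation. *)
HB.mixin Record isCStarAlgebra (R : realType) A
    of CompleteNormedModule R[i] A := {
  cone : A;
  cmul : A -> A -> A;
  star : A -> A;
  cmulA : associative cmul;
  cmul1x : left_id cone cmul;
  cmulx1 : right_id cone cmul;
  cmulDl : left_distributive cmul +%R;
  cmulDr : right_distributive cmul +%R;
  cscalerAl : forall (k : R[i]) (x y : A), k *: cmul x y = cmul (k *: x) y;
  cscalerAr : forall (k : R[i]) (x y : A), k *: cmul x y = cmul x (k *: y);
  starK : involutive star;
  starD : {morph star : x y / x + y};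
  starZ : forall (k : R[i]) (x : A), star (k *: x) = k^* *: star x;
  starM : forall x y : A, star (cmul x y) = cmul (star y) (star x);
  cnormM : forall x y : A, `|cmul x y| <= `|x| * `|y|;
  cnorm_star : forall x : A, `|cmul (star x) x| = `|x| ^+ 2
}.

#[short(type="cstarAlgType")]
HB.structure Definition CStarAlgebra (R : realType) :=
  {A of CompleteNormedModule R[i] A & isCStarAlgebra R A}.

Record starHom (R : realType) (A B : cstarAlgType R) := StarHom {
  starHom_fun :> A -> B;
  starHom_linear : linear starHom_fun;
  starHom1 : starHom_fun cone = cone;
  starHomM : {morph starHom_fun : x y / cmul x y};
  starHom_star : {morph starHom_fun : x / star x}
}.

Lemma starHomP (R : realType) (A B : cstarAlgType R) (f g : starHom A B) :
  f =1 g -> f = g.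
Proof.
case: f => f f1 f2 f3 f4; case: g => g g1 g2 g3 g4 /= /funext fg.
by subst g; congr StarHom; exact: Prop_irrelevance.
Qed.

HB.instance Definition _ (R : realType) (A B : cstarAlgType R) :=
  gen_eqMixin (starHom A B).
HB.instance Definition _ (R : realType) (A B : cstarAlgType R) :=
  gen_choiceMixin (starHom A B).

Definition starHom_id (R : realType) (A : cstarAlgType R) : starHom A A :=
  @StarHom R A A idfun (fun _ _ _ => erefl) erefl (fun _ _ => erefl)
    (fun _ => erefl).

Program Definition starHom_comp (R : realType) (A B C : cstarAlgType R)
    (g : starHom B C) (f : starHom A B) : starHom A C :=
  @StarHom R A C (g \o f) _ _ _ _.
Next Obligation. by move=> R A B C g f k x y /=; rewrite !starHom_linear. Qed.
Next Obligation. by move=> R A B C g f /=; rewrite !starHom1. Qed.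
Next Obligation. by move=> R A B C g f x y /=; rewrite !starHomM. Qed.
Next Obligation. by move=> R A B C g f x /=; rewrite !starHom_star. Qed.

Program Definition Cstar (R : realType) : category :=
  @Category (cstarAlgType R) (fun A B => starHom A B)
    (@starHom_id R) (fun A B C g f => starHom_comp g f) _ _ _.
Next Obligation. by move=> R A B f; exact: starHomP. Qed.
Next Obligation. by move=> R A B f; exact: starHomP. Qed.
Next Obligation. by move=> R A B C D h g f; exact: starHomP. Qed.

Definition is_commutative (R : realType) (A : Cstar R) : Prop :=
  commutative (@cmul R A).

Definition cCstar (R : realType) : category :=
  full_subcategory (@is_commutative R).

(* A copy of [R[i]] as a module over itself, on which the instances below
   do not compete with those of the library on [GRing.regular]. *)
Definition complexes (R : realType) : Type := R[i]^o.

HB.instance Definition _ (R : realType) :=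
  NormedModule.copy (complexes R) R[i]^o.

Section complexes.
Variable R : realType.

Lemma gt0_complexE (e : R[i]) : 0 < e -> exists2 r : R, 0 < r & e = r%:C%C.
Proof.
case: e => a b; rewrite ltcE /= => /andP[/eqP b0 a0].
by exists a => //; rewrite b0.
Qed.

Lemma normc_ge_Im (z : R[i]) : `|complex.Im z|%:C%C <= `|z|.
Proof.
by case: z => a b; rewrite normc_def lecR -sqrtr_sqr ler_wsqrtr // lerDr sqr_ge0.
Qed.

Lemma normc_le_ReIm (z : R[i]) :
  `|z| <= (`|complex.Re z| + `|complex.Im z|)%:C%C.
Proof.
rewrite normc_def lecR -[leRHS]ger0_norm ?addr_ge0 // -[leRHS]sqrtr_sqr.
rewrite ler_wsqrtr // sqrrD !real_normK ?num_real //.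
by rewrite addrAC lerDl mulrn_wge0 // mulr_ge0.
Qed.

Lemma complexes_complete (F : set_system (complexes R)) :
  ProperFilter F -> cauchy F -> cvg F.
Proof.
move=> FF Fc.
have /cauchy_ballP Fcb := Fc.
have cvg_part (p : R[i] -> R) :
    (forall x y, p (x - y) = p x - p y) ->
    (forall z, `|p z|%:C%C <= `|z|) ->
    cvg ((p : complexes R -> R) @ F).
  move=> pB ple; apply: R_complete; apply/cauchy_ballP => e e0.
  have e0' : (0 : R[i]) < e%:C%C by rewrite ltcR.
  rewrite near_map2.
  apply: filterS (Fcb _ e0') => -[x y] /=.
  rewrite -!ball_normE /= -pB => h.
  by rewrite -ltcR; apply: le_lt_trans (ple _) h.
have /cvg_ex[a Fa] := cvg_part (@complex.Re R) (@raddfB _ _ _) (@normc_ge_Re R).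
have /cvg_ex[b Fb] := cvg_part (@complex.Im R) (@raddfB _ _ _) normc_ge_Im.
apply/cvg_ex; exists (Complex a b : complexes R).
apply/cvgrPdist_lt => _ /gt0_complexE[e e0 ->].
have e2 : 0 < e / 2 by rewrite divr_gt0.
near=> z.
apply: le_lt_trans (normc_le_ReIm _) _.
rewrite ltcR [e]splitr; apply: ltrD.
  rewrite raddfB /=.
  near: z. move/cvgrPdist_lt : Fa; exact.
rewrite raddfB /=.
near: z. move/cvgrPdist_lt : Fb; exact.
Unshelve. all: by end_near. Qed.

HB.instance Definition _ :=
  Uniform_isComplete.Build (complexes R) complexes_complete.

Local Notation C := R[i].

Let conjCM (x y : C) : (x * y)^* = y^* * x^*.
Proof. by rewrite mulrC; exact: (rmorphM (@Num.conj C)). Qed.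
Let normCM (x y : C) : `|x * y| <= `|x| * `|y|.
Proof. by rewrite normrM. Qed.
Let normC_star (x : C) : `|x^* * x| = `|x| ^+ 2.
Proof.
rewrite mulrC.
by have := sqr_normc x => <-; rewrite ger0_norm ?exprn_ge0.
Qed.

HB.instance Definition _ := @isCStarAlgebra.Build R (complexes R)
  (1 : C) (@GRing.mul C) (@Num.conj C)
  (@mulrA C) (@mul1r C) (@mulr1 C) (@mulrDl C) (@mulrDr C)
  (@mulrA C) (@mulrCA C) (@conjCK C) (rmorphD (@Num.conj C))
  (rmorphM (@Num.conj C)) conjCM normCM normC_star.
End complexes.

Definition characters (R : realType) (A : cstarAlgType R) : topologicalType :=
  initial_topology (fun chi : starHom A (complexes R) =>
    (chi : {ptws A -> complexes R})).

Definition precomp (R : realType) (A B : cstarAlgType R) (f : starHom A B)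
    (chi : characters B) : characters A := starHom_comp chi f.

Lemma precomp_continuous (R : realType) (A B : cstarAlgType R)
  (f : starHom A B) : continuous (precomp f).
Proof.
apply: continuous_comp_initial => chi.
have chiF : Filter (nbhs chi) by exact: nbhs_filter.
apply/(@pointwise_cvgP A (complexes R) _ _ (fmap_filter _ chiF)) => a.
have eval_cont : continuous (fun psi : characters B => psi (f a)).
  move=> psi; apply: (@continuous_comp _ _ _
    (fun psi : characters B => psi : {ptws B -> complexes R})
    (fun g : {ptws B -> complexes R} => g (f a))).
    exact: initial_continuous.
  exact: (@proj_continuous B (fun=> complexes R) (f a)).
exact: eval_cont.
Qed.

Program Definition Spec (R : realType) : functor (op (cCstar R)) Top :=
  @Functor (op (cCstar R)) Top (fun A => characters (sval A))
    (fun A B f => mkcts (@precomp_continuous R _ _ f)) _ _.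
Next Obligation.
by move=> R A; apply/continuousEP => chi; exact: starHomP.
Qed.
Next Obligation.
by move=> R A B C g f; apply/continuousEP => chi; exact: starHomP.
Qed.

Section operator_norm.
Variable R : realType.
Local Notation C := R[i].
Import ComplexField.Normc.

Definition norm2 n (v : 'cV[C]_n) : R :=
  Num.sqrt (\sum_i normc (v i 0) ^+ 2).

(* The operator norm for the Euclidean norm [norm2] on C^n. *)
Definition opnorm n (A : 'M[C]_n) : R :=
  sup [set norm2 (A *m v) | v in [set v | norm2 v <= 1]].

Definition adjoint n (A : 'M[C]_n) : 'M[C]_n := map_mx Num.conj A^T.

Lemma normcE' (z : C) : (normc z)%:C%C = `|z|.
Proof. by []. Qed.

Lemma normc_ge0 (z : C) : 0 <= normc z.
Proof. by case: z => a b; exact: sqrtr_ge0. Qed.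

Lemma normc_conj (z : C) : normc z^* = normc z.
Proof. by case: z => a b /=; rewrite sqrrN. Qed.

Lemma normc_sum I (r : seq I) (F : I -> C) :
  normc (\sum_(i <- r) F i) <= \sum_(i <- r) normc (F i).
Proof.
elim/big_ind2 : _ => [|x1 x2 y1 y2 h1 h2|//]; first by rewrite normc0.
exact: le_trans (le_normcD _ _) (lerD h1 h2).
Qed.

Lemma sum_CS n (a b : 'I_n -> R) :
  \sum_i a i * b i <=
    Num.sqrt (\sum_i a i ^+ 2) * Num.sqrt (\sum_i b i ^+ 2).
Proof.
set A := \sum_i a i ^+ 2; set B := \sum_i b i ^+ 2.
have A0 : 0 <= A by apply: sumr_ge0 => i _; exact: sqr_ge0.
have B0 : 0 <= B by apply: sumr_ge0 => i _; exact: sqr_ge0.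
have zero (f : 'I_n -> R) : \sum_i f i ^+ 2 = 0 -> forall i, f i = 0.
  move=> /eqP; rewrite psumr_eq0; last by move=> i _; exact: sqr_ge0.
  by move=> /allP h i; apply/eqP; rewrite -sqrf_eq0; apply: h; rewrite mem_index_enum.
have [A00|An0] := eqVneq A 0.
  rewrite big1 ?mulr_ge0 ?sqrtr_ge0 // => i _.
  by rewrite (zero _ A00) mul0r.
have [B00|Bn0] := eqVneq B 0.
  rewrite big1 ?mulr_ge0 ?sqrtr_ge0 // => i _.
  by rewrite (zero _ B00) mulr0.
set s := Num.sqrt A; set t := Num.sqrt B.
have s2 : s ^+ 2 = A by rewrite sqr_sqrtr.
have t2 : t ^+ 2 = B by rewrite sqr_sqrtr.
have st0 : 0 < s * t by rewrite mulr_gt0 // sqrtr_gt0 lt_def ?An0 ?Bn0.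
have : 0 <= \sum_i (t * a i - s * b i) ^+ 2.
  by apply: sumr_ge0 => i _; exact: sqr_ge0.
have -> : \sum_i (t * a i - s * b i) ^+ 2 =
    \sum_i (t ^+ 2 * a i ^+ 2 + s ^+ 2 * b i ^+ 2
            - (s * t) *+ 2 * (a i * b i)).
  by apply: eq_bigr => i _; ring.
rewrite sumrB big_split /= -!mulr_sumr -/A -/B s2 t2 -s2 -t2 subr_ge0.
have -> : t ^+ 2 * s ^+ 2 + s ^+ 2 * t ^+ 2 = (s * t) *+ 2 * (s * t) by ring.
by rewrite ler_pM2l // pmulrn_lgt0.
Qed.

Section norm2.
Variable n : nat.
Implicit Types (u v : 'cV[C]_n).

Lemma norm2_ge0 v : 0 <= norm2 v. Proof. exact: sqrtr_ge0. Qed.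

Lemma norm2_sqr v : norm2 v ^+ 2 = \sum_i normc (v i 0) ^+ 2.
Proof. by rewrite sqr_sqrtr // sumr_ge0 // => i _; exact: sqr_ge0. Qed.

Lemma norm2_sqrC v : (norm2 v ^+ 2)%:C%C = \sum_i (v i 0)^* * v i 0.
Proof.
rewrite norm2_sqr rmorph_sum; apply: eq_bigr => i _.
by rewrite rmorphXn /= normcE' mulrC sqr_normc.
Qed.

Lemma norm2_eq0 v : norm2 v = 0 -> v = 0.
Proof.
move=> v0; apply/colP => i; rewrite mxE.
have /eqP := norm2_sqr v; rewrite v0 expr0n /= eq_sym psumr_eq0; last first.
  by move=> j _; exact: sqr_ge0.
move=> /allP /(_ i (mem_index_enum _)) /=; rewrite sqrf_eq0 => /eqP.
exact: eq0_normc.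
Qed.

Lemma norm2_0 : norm2 (0 : 'cV[C]_n) = 0.
Proof.
by rewrite /norm2 big1 ?sqrtr0 // => i _; rewrite mxE normc0 expr0n.
Qed.

Lemma norm2Z (k : C) v : norm2 (k *: v) = normc k * norm2 v.
Proof.
rewrite /norm2 -[normc k]ger0_norm ?normc_ge0 // -sqrtr_sqr -sqrtrM ?sqr_ge0 //.
by rewrite mulr_sumr; congr Num.sqrt; apply: eq_bigr => i _;
  rewrite mxE normcM exprMn.
Qed.

Lemma dot_le u v :
  normc (\sum_i (u i 0)^* * v i 0) <= norm2 u * norm2 v.
Proof.
apply: le_trans (normc_sum _ _) _; apply: le_trans (sum_CS _ _).
by apply: ler_sum => i _; rewrite normcM normc_conj.
Qed.

Lemma norm2D u v : norm2 (u + v) <= norm2 u + norm2 v.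
Proof.
rewrite -(@ler_pXn2r _ 2) ?nnegrE ?addr_ge0 ?norm2_ge0 //.
rewrite norm2_sqr sqrrD !norm2_sqr.
apply: (@le_trans _ _ (\sum_i (normc (u i 0) + normc (v i 0)) ^+ 2)).
  apply: ler_sum => i _; rewrite mxE ler_pXn2r ?nnegrE ?addr_ge0 ?normc_ge0 //.
  exact: le_normcD.
have -> : \sum_i (normc (u i 0) + normc (v i 0)) ^+ 2 =
    \sum_i normc (u i 0) ^+ 2 + (\sum_i normc (u i 0) * normc (v i 0)) *+ 2 +
    \sum_i normc (v i 0) ^+ 2.
  by rewrite -sumrMnl -!big_split /=; apply: eq_bigr => i _; rewrite sqrrD.
by rewrite lerD2r lerD2l lerMn2r /= sum_CS.
Qed.

Lemma norm2_coord v i : normc (v i 0) <= norm2 v.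
Proof.
rewrite -(@ler_pXn2r _ 2) ?nnegrE ?norm2_ge0 ?normc_ge0 // norm2_sqr.
rewrite (bigD1 i) //= lerDl; apply: sumr_ge0 => j _; exact: sqr_ge0.
Qed.

Lemma norm2_delta (i : 'I_n) : norm2 (delta_mx i 0) = 1.
Proof.
rewrite /norm2 (bigD1 i) //= big1 => [|j ji].
  by rewrite mxE !eqxx normc1 expr1n addr0 sqrtr1.
by rewrite mxE (negbTE ji) normc0 expr0n.
Qed.

Lemma norm2_le_sum v : norm2 v <= \sum_i normc (v i 0).
Proof.
rewrite [v in leLHS](_ : v = \sum_i v i 0 *: delta_mx i 0); last first.
  by rewrite [LHS]matrix_sum_delta; apply: eq_bigr => i _; rewrite big_ord1.
elim/big_ind2 : _ => [|x1 x2 y1 y2 h1 h2|i _]; first by rewrite norm2_0.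
  exact: le_trans (norm2D _ _) (lerD h1 h2).
by rewrite norm2Z norm2_delta mulr1.
Qed.

Lemma norm2_mul_le_sum (A : 'M[C]_n) v :
  norm2 (A *m v) <= (\sum_i \sum_j normc (A i j)) * norm2 v.
Proof.
apply: le_trans (norm2_le_sum _) _; rewrite mulr_suml; apply: ler_sum => i _.
rewrite mxE mulr_suml; apply: le_trans (normc_sum _ _) _.
by apply: ler_sum => j _; rewrite normcM ler_wpM2l ?normc_ge0 // norm2_coord.
Qed.

Lemma opnorm_has_sup (A : 'M[C]_n) :
  has_sup [set norm2 (A *m v) | v in [set v | norm2 v <= 1]].
Proof.
split; first by exists 0, 0; rewrite /= ?norm2_0 ?mulmx0 ?norm2_0 ?ler01.
exists (\sum_i \sum_j normc (A i j)) => _ [v /= v1 <-].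
apply: le_trans (norm2_mul_le_sum _ _) _.
by rewrite ler_piMr // !sumr_ge0 // => i _; rewrite sumr_ge0 // => j _;
  exact: normc_ge0.
Qed.

Lemma opnorm_ge0 (A : 'M[C]_n) : 0 <= opnorm A.
Proof.
apply: (sup_upper_bound (opnorm_has_sup A)).
by exists 0; rewrite /= ?norm2_0 ?mulmx0 ?norm2_0 ?ler01.
Qed.

Lemma opnorm_bound (A : 'M[C]_n) v : norm2 (A *m v) <= opnorm A * norm2 v.
Proof.
have [v0|vn0] := eqVneq (norm2 v) 0.
  by rewrite v0 mulr0 (norm2_eq0 v0) mulmx0 norm2_0.
have vp : 0 < norm2 v by rewrite lt_def vn0 norm2_ge0.
have nV : normc ((norm2 v)^-1)%:C%C = (norm2 v)^-1.
  by rewrite /= expr0n addr0 sqrtr_sqr ger0_norm // invr_ge0 ltW.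
rewrite -ler_pdivrMr // mulrC -nV -norm2Z scalemxAr.
apply: (sup_upper_bound (opnorm_has_sup A)); exists (((norm2 v)^-1)%:C%C *: v) => //=.
by rewrite norm2Z nV mulVf.
Qed.

Lemma opnorm_le (A : 'M[C]_n) c : 0 <= c ->
  (forall v, norm2 (A *m v) <= c * norm2 v) -> opnorm A <= c.
Proof.
move=> c0 h; apply: ge_sup.
  by have [] := opnorm_has_sup A.
by move=> _ [v /= v1 <-]; apply: le_trans (h v) _; rewrite ler_piMr.
Qed.

Lemma opnormD (A B : 'M[C]_n) : opnorm (A + B) <= opnorm A + opnorm B.
Proof.
apply: opnorm_le => [|v]; first by rewrite addr_ge0 ?opnorm_ge0.
rewrite mulmxDl mulrDl; apply: le_trans (norm2D _ _) _.
by rewrite lerD ?opnorm_bound.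
Qed.

Lemma opnormZ_le (k : C) (A : 'M[C]_n) : opnorm (k *: A) <= normc k * opnorm A.
Proof.
apply: opnorm_le => [|v]; first by rewrite mulr_ge0 ?normc_ge0 ?opnorm_ge0.
by rewrite -scalemxAl norm2Z -mulrA ler_wpM2l ?normc_ge0 ?opnorm_bound.
Qed.

Lemma opnormZ (k : C) (A : 'M[C]_n) : opnorm (k *: A) = normc k * opnorm A.
Proof.
apply/le_anti; rewrite opnormZ_le /=.
have [->|k0] := eqVneq k 0; first by rewrite normc0 mul0r opnorm_ge0.
have nk : 0 < normc k.
  rewrite lt_def normc_ge0 andbT; apply: contra_neq k0; exact: eq0_normc.
rewrite -ler_pdivlMl // -normcV.
have {1}<- : k^-1 *: (k *: A) = A by rewrite scalerA mulVf // scale1r.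
exact: opnormZ_le.
Qed.

Lemma opnorm_coord (A : 'M[C]_n) i j : normc (A i j) <= opnorm A.
Proof.
have := opnorm_bound A (delta_mx j 0); rewrite norm2_delta mulr1.
by apply: le_trans; have := norm2_coord (A *m delta_mx j 0) i; rewrite -colE mxE.
Qed.

Lemma opnorm_le_sum (A : 'M[C]_n) : opnorm A <= \sum_i \sum_j normc (A i j).
Proof.
apply: opnorm_le => [|v]; last exact: norm2_mul_le_sum.
by rewrite !sumr_ge0 // => i _; rewrite sumr_ge0 // => j _; exact: normc_ge0.
Qed.

Lemma opnorm_eq0 (A : 'M[C]_n) : opnorm A = 0 -> A = 0.
Proof.
move=> A0; apply/matrixP => i j; rewrite mxE; apply: eq0_normc.
by apply/le_anti; rewrite normc_ge0 andbT -A0 opnorm_coord.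
Qed.

Lemma opnormM (A B : 'M[C]_n) : opnorm (A *m B) <= opnorm A * opnorm B.
Proof.
apply: opnorm_le => [|v]; first by rewrite mulr_ge0 ?opnorm_ge0.
rewrite -mulmxA; apply: le_trans (opnorm_bound _ _) _.
by rewrite -mulrA ler_wpM2l ?opnorm_ge0 ?opnorm_bound.
Qed.

Lemma adjointK : involutive (@adjoint n).
Proof. by move=> A; apply/matrixP => i j; rewrite !mxE; exact: conjCK. Qed.

Lemma adjointD : {morph @adjoint n : A B / A + B}.
Proof. by move=> A B; rewrite /adjoint linearD /= map_mxD. Qed.

Lemma adjointZ (k : C) (A : 'M[C]_n) : adjoint (k *: A) = k^* *: adjoint A.
Proof. by rewrite /adjoint linearZ /= map_mxZ. Qed.

Lemma adjointM (A B : 'M[C]_n) :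
  adjoint (A *m B) = adjoint B *m adjoint A.
Proof. by rewrite /adjoint trmx_mul map_mxM. Qed.

Lemma norm2_adjoint (A : 'M[C]_n) v :
  (norm2 (A *m v) ^+ 2)%:C%C =
  \sum_i (v i 0)^* * (adjoint A *m A *m v) i 0.
Proof.
rewrite norm2_sqrC -mulmxA; set w := A *m v.
under [RHS]eq_bigr => i _ do rewrite mxE mulr_sumr.
rewrite exchange_big /=; apply: eq_bigr => j _.
rewrite /w [in LHS]mxE rmorph_sum mulr_suml; apply: eq_bigr => i _.
by rewrite !mxE rmorphM mulrA [_^* * _^*]mulrC.
Qed.

Lemma opnorm_cstar_ge (A : 'M[C]_n) :
  opnorm A ^+ 2 <= opnorm (adjoint A *m A).
Proof.
rewrite -[leRHS]sqr_sqrtr ?opnorm_ge0 //.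
rewrite ler_pXn2r ?nnegrE ?opnorm_ge0 ?sqrtr_ge0 //.
apply: opnorm_le => [|v]; first exact: sqrtr_ge0.
rewrite -(@ler_pXn2r _ 2) ?nnegrE ?mulr_ge0 ?sqrtr_ge0 ?norm2_ge0 //.
rewrite exprMn (sqr_sqrtr (opnorm_ge0 _)).
have -> : norm2 (A *m v) ^+ 2 = normc (norm2 (A *m v) ^+ 2)%:C%C.
  by rewrite /= expr0n addr0 sqrtr_sqr ger0_norm // sqr_ge0.
rewrite norm2_adjoint; apply: le_trans (dot_le _ _) _.
rewrite mulrC expr2 mulrA ler_wpM2r ?norm2_ge0 //.
exact: opnorm_bound.
Qed.

Lemma opnorm_adjoint_le (A : 'M[C]_n) : opnorm A <= opnorm (adjoint A).
Proof.
have [->|A0] := eqVneq (opnorm A) 0; first exact: opnorm_ge0.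
have Ap : 0 < opnorm A by rewrite lt_def A0 opnorm_ge0.
rewrite -(ler_pM2r Ap) -expr2; apply: le_trans (opnorm_cstar_ge _) _.
exact: opnormM.
Qed.

Lemma opnorm_cstar (A : 'M[C]_n) :
  opnorm (adjoint A *m A) = opnorm A ^+ 2.
Proof.
apply/le_anti; rewrite opnorm_cstar_ge andbT.
apply: le_trans (opnormM _ _) _; rewrite expr2 ler_wpM2r ?opnorm_ge0 //.
by have := opnorm_adjoint_le (adjoint A); rewrite adjointK.
Qed.
End norm2.
End operator_norm.

(* A copy of ['M[R[i]]_n] that carries the operator norm, whereas the library
   puts the maximum norm on matrices. *)
Definition cmatrix (R : realType) (n : nat) : Type := 'M[R[i]]_n.

HB.instance Definition _ (R : realType) (n : nat) :=
  GRing.Lmodule.on (cmatrix R n).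

Section cmatrix.
Variables (R : realType) (n : nat).
Import ComplexField.Normc.
Local Notation C := R[i].

Let norm (A : cmatrix R n) : C := (opnorm A)%:C%C.

Let normD (A B : cmatrix R n) : norm (A + B) <= norm A + norm B.
Proof. by rewrite -rmorphD lecR; exact: opnormD. Qed.
Let normZ (k : C) (A : cmatrix R n) : norm (k *: A) = `|k| * norm A.
Proof. by rewrite /norm opnormZ rmorphM. Qed.
Let norm_eq0 (A : cmatrix R n) : norm A = 0 -> A = 0.
Proof. by move=> /complexI; exact: opnorm_eq0. Qed.

HB.instance Definition _ :=
  Lmodule_isNormed.Build C (cmatrix R n) normD normZ norm_eq0.

Lemma cmatrix_normE (A : cmatrix R n) : `|A| = (opnorm A)%:C%C.
Proof. by []. Qed.

Lemma cmatrix_complete (F : set_system (cmatrix R n)) :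
  ProperFilter F -> cauchy F -> cvg F.
Proof.
move=> FF /cauchy_ballP Fc.
pose G : set_system 'M[complexes R]_n := F.
have FG : ProperFilter G by [].
have /cauchy_cvg /cvg_ex[M GM] : cauchy G.
  apply/cauchy_ballP => e e0.
  apply: filterS (Fc _ e0) => -[A B] h.
  move: h; rewrite -[X in X -> _]/(ball (A : cmatrix R n) e B) -ball_normE /=.
  rewrite cmatrix_normE => h; split=> // i j.
  have := opnorm_coord (A - B : 'M[C]_n) i j; rewrite -lecR !mxE => hij.
  by rewrite -ball_normE /=; exact: (@le_lt_trans _ C _ _ _ hij h).
apply/cvg_ex; exists (M : cmatrix R n); apply/cvgrPdist_lt => _ /gt0_complexE[e e0 ->].
have d0 : 0 < e / (n * n).+1%:R by rewrite divr_gt0.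
have : \forall A  \near G, ball M (e / (n * n).+1%:R)%:C%C A.
  by apply: (GM); apply: nbhsx_ballx; rewrite ltcR.
apply: filterS => A [_ MA]; rewrite cmatrix_normE ltcR.
apply: le_lt_trans (opnorm_le_sum _) _.
apply: (@le_lt_trans _ _ (\sum_(i < n) \sum_(j < n) e / (n * n).+1%:R)).
  apply: ler_sum => i _; apply: ler_sum => j _.
  by move: (MA i j); rewrite -ball_normE /= ltcR !mxE => /ltW.
rewrite !sumr_const !card_ord -mulrnA -[ltLHS]mulr_natr mulrAC -mulrA.
by rewrite gtr_pMr // ltr_pdivrMr // mul1r ltr_nat.
Qed.

HB.instance Definition _ :=
  Uniform_isComplete.Build (cmatrix R n) cmatrix_complete.

Let scalemxAr' (k : C) (A B : 'M[C]_n) : k *: (A *m B) = A *m (k *: B).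
Proof. by rewrite scalemxAr. Qed.
Let normM (A B : cmatrix R n) :
  `|(A *m B : cmatrix R n)| <= `|A| * `|B|.
Proof. by rewrite !cmatrix_normE -rmorphM lecR; exact: opnormM. Qed.
Let norm_star (A : cmatrix R n) :
  `|(adjoint A *m A : cmatrix R n)| = `|A| ^+ 2.
Proof. by rewrite !cmatrix_normE -rmorphXn /= opnorm_cstar. Qed.

HB.instance Definition _ := @isCStarAlgebra.Build R (cmatrix R n)
  1%:M (@mulmx C n n n) (@adjoint R n)
  (@mulmxA C n n n n) (@mul1mx C n n) (@mulmx1 C n n)
  (@mulmxDl C n n n) (@mulmxDr C n n n) (@scalemxAl C n n n) scalemxAr'
  (@adjointK R n) (@adjointD R n) (@adjointZ R n) (@adjointM R n)
  normM norm_star.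
End cmatrix.

(* Main.v *)
Require Import Defs.
From HB Require Import structures.
From mathcomp Require Import all_boot all_order all_algebra.
From mathcomp Require Import all_classical all_reals all_analysis.
From mathcomp Require Import complex ring.

(** A point [x] of [G (cmatrix R n)] would assign to every *-homomorphism
    [f : A -> M_n(C)] from a commutative [A] a character [chi x f] of [A], namely
    the image of [G f x] under the isomorphism of [G A] with the spectrum of
    [A]. By naturality these characters are compatible: [chi x (f \o h)] is
    [chi x f \o h] ([chi_comp]). This is a hidden-variable assignment, and the
    theorem of Kochen and Specker forbids it for [n >= 3].

    To reach that theorem, only the algebra [A = C^3] is needed. Two orthogonal
    projections [p] and [q] define a *-homomorphism [C^3 -> M_n(C)] sending
    [(a, b, c)] to [a p + b q + c (1 - p - q)]. Evaluating the resulting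
    character at the idempotent [(1, 0, 0)] gives a number in {0, 1}.
    Compatibility along the reindexings of coordinates [C^3 -> C^3] shows that
    this number depends on [p] only and that it is additive on orthogonal
    projections ([point_measure_two_valued]): a {0, 1}-valued measure on the
    projections of [M_n(C)].

    No such measure [v] exists when [n >= 3] ([kochen_specker]); the argument is
    the one given by Bell in 1966. Write [v u] for the value at the projection
    onto the line of [u]. Additivity gives two rules: of two orthogonal vectors
    at most one has value 1, and if two orthogonal vectors have value 0, so has
    their whole span. From these rules alone, if [a] has value 1, [b] is
    orthogonal to [a] and [2 |b| <= |a|], then [a + b] has value 1 as well
    ([bell_step]); the proof uses a third direction orthogonal to [a] and [b].
    Value 1 is thus inherited by all vectors close in angle, with a uniform
    bound on the angle. Some basis vector [e1] has value 1
    since the values on a basis sum to [v 1 = 1]; two steps lead from [e1] to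
    [e1 + e2], and by symmetry to [e1 - e2]. These two are orthogonal, which is a
    contradiction. *)

Set Implicit Arguments.
Unset Strict Implicit.
Unset Printing Implicit Defensive.
Import Order.TTheory GRing.Theory Num.Theory.
Import numFieldNormedType.Exports.
Local Open Scope ring_scope.
Local Open Scope sesquilinear_scope.

(** * Two-valued measures on the projections of a matrix algebra *)

Section two_valued_measures.
Variables (C : numClosedFieldType) (n : nat).
Implicit Types (p q : 'M[C]_n) (u w x : 'rV[C]_n).
Local Notation "''[' u , w ]" := (dotmx u w) : ring_scope.
Local Notation "''[' u ]" := '[u, u] : ring_scope.

Definition projection p := p *m p = p /\ p^t* = p.

Lemma trmxCM m k l (A : 'M[C]_(m, k)) (B : 'M[C]_(k, l)) :
  (A *m B)^t* = B^t* *m A^t*.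
Proof. by rewrite trmx_mul map_mxM. Qed.

Lemma projection_mul0C p q : projection p -> projection q ->
  p *m q = 0 -> q *m p = 0.
Proof.
by move=> [_ ps] [_ qs] pq0; rewrite -ps -qs -trmxCM pq0 trmx0 map_mx0.
Qed.

Lemma projectionD p q : projection p -> projection q -> p *m q = 0 ->
  projection (p + q).
Proof.
move=> pP qP pq0; have qp0 := projection_mul0C pP qP pq0.
case: pP qP => [pp ps] [qq qs].
split; last by rewrite linearD map_mxD /= ps qs.
by rewrite mulmxDl !mulmxDr pp qq pq0 qp0 addr0 add0r.
Qed.

Lemma projectionB p q : projection p -> projection q -> q *m p = q ->
  projection (p - q).
Proof.
move=> [pp ps] [qq qs] qpq.
have pqq : p *m q = q by rewrite -{1}ps -{1}qs -trmxCM qpq.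
split; last by rewrite linearB map_mxB /= ps qs.
by rewrite mulmxBl !mulmxBr pp qq qpq pqq subrr subr0.
Qed.

Lemma projection0 : projection 0.
Proof. by split; rewrite ?mulmx0 // trmx0 map_mx0. Qed.

Lemma projection1 : projection 1%:M.
Proof. by split; rewrite ?mulmx1 // trmx1 map_mx1. Qed.

(** [v] is a function of all matrices so as to avoid a subtype of projections. *)
Definition two_valued_measure (v : 'M[C]_n -> C) :=
  [/\ v 1%:M = 1,
      forall p, projection p -> v p = 0 \/ v p = 1 &
      forall p q, projection p -> projection q -> p *m q = 0 ->
        v (p + q) = v p + v q].

(** The orthogonal projection onto the line of [u]; it is [0] for [u = 0], so
    that the lemmas below hold for every vector. *)
Definition line_proj u : 'M[C]_n := '[u]^-1 *: (u^t* *m u).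

Lemma mul_line_proj u w : w *m line_proj u = ('[w, u] / '[u]) *: u.
Proof.
rewrite /line_proj -scalemxAr mulmxA [w *m _]mx11_scalar -dotmxE.
by rewrite mul_scalar_mx scalerA mulrC.
Qed.

Lemma line_proj_id u : u *m line_proj u = u.
Proof.
rewrite mul_line_proj; have [->|u0] := eqVneq u 0; first exact: scaler0.
by rewrite divff ?scale1r // dnorm_eq0.
Qed.

Lemma line_proj_projection u : projection (line_proj u).
Proof.
split; first by rewrite {1}/line_proj -scalemxAl -mulmxA line_proj_id.
rewrite /line_proj linearZ map_mxZ /= trmxCM trmxCK fmorphV.
by congr (_^-1 *: _); apply/geC0_conj/dnorm_ge0.
Qed.

Lemma line_proj_mul0 u w : '[u, w] = 0 -> line_proj u *m line_proj w = 0.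
Proof.
move=> uw; rewrite {1}/line_proj -scalemxAl -mulmxA mul_line_proj uw.
by rewrite mul0r scale0r mulmx0 scaler0.
Qed.

Lemma line_proj_le x p : x *m p = x -> line_proj x *m p = line_proj x.
Proof. by move=> xp; rewrite /line_proj -scalemxAl -mulmxA xp. Qed.

Lemma dotmx_eq0C u w : '[u, w] = 0 -> '[w, u] = 0.
Proof. by move/eqP; rewrite herm_eq0C => /eqP. Qed.

Lemma trmxC_delta (i : 'I_n) :
  (delta_mx 0 i : 'rV[C]_n)^t* = delta_mx i 0.
Proof. by apply/matrixP => k l; rewrite !mxE conjC_nat andbC. Qed.

Lemma dotmx_delta (i j : 'I_n) :
  '[delta_mx 0 i : 'rV[C]_n, delta_mx 0 j] = (i == j)%:R.
Proof.
by rewrite dotmxE trmxC_delta mul_delta_mx_cond mulmxnE mxE eqxx.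
Qed.

Lemma line_proj_delta (i : 'I_n) :
  line_proj (delta_mx 0 i : 'rV[C]_n) = delta_mx i i.
Proof.
rewrite /line_proj dotmx_delta eqxx invr1 scale1r.
by rewrite trmxC_delta mul_delta_mx.
Qed.

Section measure.
Variable v : 'M[C]_n -> C.
Hypothesis v_measure : two_valued_measure v.

Lemma measure0 : v 0 = 0.
Proof.
have [_ _ /(_ 0 0 projection0 projection0)] := v_measure.
rewrite mulmx0 addr0 => /(_ erefl)/eqP.
by rewrite -subr_eq0 opprD addNKr oppr_eq0 => /eqP.
Qed.

(** The values of [p - q] and [q] add up to that of [p]; being 0 or 1, they
    cannot cancel. *)
Lemma measure_le0 p q : projection p -> projection q -> q *m p = q ->
  v p = 0 -> v q = 0.
Proof.
move=> pP qP qpq vp0; have [_ v01 vD] := v_measure.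
have pqP := projectionB pP qP qpq.
have qpq0 : q *m (p - q) = 0 by rewrite mulmxBr qpq qP.1 subrr.
have := vD _ _ qP pqP qpq0; rewrite subrKC vp0.
case: (v01 _ qP) => -> //; case: (v01 _ pqP) => -> /esym/eqP.
  by rewrite addr0 oner_eq0.
by rewrite (_ : 1 + 1 = 2%:R) // pnatr_eq0.
Qed.

Lemma measure_orth0 u w : '[u, w] = 0 ->
  v (line_proj u) <> 0 -> v (line_proj w) = 0.
Proof.
move=> uw vu; have [_ v01 vD] := v_measure.
have uP := line_proj_projection u; have wP := line_proj_projection w.
have uw0 := line_proj_mul0 uw; have := vD _ _ uP wP uw0.
case: (v01 _ uP) => // ->; case: (v01 _ wP) => // ->.
case: (v01 _ (projectionD uP wP uw0)) => -> /esym/eqP.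
  by rewrite (_ : 1 + 1 = 2%:R) // pnatr_eq0.
by rewrite (_ : 1 + 1 = 2%:R) // pnatr_eq1.
Qed.

(** The projection onto the plane of [u] and [w] has value 0 by additivity,
    hence so has every line in it. *)
Lemma measure_span0 u w k l : '[u, w] = 0 ->
  v (line_proj u) = 0 -> v (line_proj w) = 0 ->
  v (line_proj (k *: u + l *: w)) = 0.
Proof.
move=> uw vu vw; have [_ _ vD] := v_measure.
have uP := line_proj_projection u; have wP := line_proj_projection w.
have uw0 := line_proj_mul0 uw.
apply: (measure_le0 (projectionD uP wP uw0)); last by rewrite vD // vu vw addr0.
  exact: line_proj_projection.
apply: line_proj_le; rewrite mulmxDl -!scalemxAl !mulmxDr !line_proj_id.
rewrite !mul_line_proj uw (dotmx_eq0C uw).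
by rewrite !mul0r !scale0r addr0 add0r.
Qed.

Lemma measure_scale0 u k : v (line_proj u) = 0 -> v (line_proj (k *: u)) = 0.
Proof.
move=> vu; have := @measure_span0 u 0 k 0; rewrite scaler0 addr0; apply=> //.
  by rewrite linear0r.
by rewrite /line_proj mulmx0 scaler0 measure0.
Qed.

Section bell.
Variables a b c : 'rV[C]_n.
Hypotheses (ab : '[a, b] = 0) (ac : '[a, c] = 0) (bc : '[b, c] = 0).

Let dotE (i j k i' j' k' : C) :
  '[i *: a + j *: b + k *: c, i' *: a + j' *: b + k' *: c] =
  i * i'^* * '[a] + j * j'^* * '[b] + k * k'^* * '[c].
Proof.
rewrite !(linearDl, linearDr) /= ![in LHS](linearZl_LR, linearZr_LR) /=.
by rewrite ab ac bc (dotmx_eq0C ab) (dotmx_eq0C ac) (dotmx_eq0C bc); ring.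
Qed.

(** The condition on [s t] makes [a + b + s c] and [- b + t c] orthogonal. Both
    lie in spans of orthogonal vectors of value 0, and their sum is
    [a + (s + t) c]. *)
Lemma bell_span0 (s t : C) : t \is Num.real -> s * t * '[c] = '[b] ->
  v (line_proj b) = 0 -> v (line_proj c) = 0 -> v (line_proj (a + b)) = 0 ->
  v (line_proj (a + (s + t) *: c)) = 0.
Proof.
move=> /CrealP t_real stb vb vc vab.
have vs : v (line_proj (1 *: (a + b) + s *: c)) = 0.
  by apply: measure_span0; rewrite // linearDl /= ac bc addr0.
have vt : v (line_proj (- 1 *: b + t *: c)) = 0 by apply: measure_span0.
have := @measure_span0 _ _ 1 1 _ vs vt.
rewrite !scale1r scaleN1r addrACA addrK scalerDl; apply.
have := dotE 1 1 s 0 (-1) t; rewrite !scale1r scale0r add0r scaleN1r => ->.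
by rewrite conjC0 rmorphN1 t_real stb; ring.
Qed.

(** If [a + b] had value 0, so would [a + r c] and [a - r c], where
    [r = s + t] and [s], [t] are as in [bell_span0]. For [r = |a| / |c|] these two
    are orthogonal, and [a] is in their span. The numbers [s] and [t] are then
    the roots of [X^2 - r X + |b|^2 / |c|^2], which are real when
    [2 |b| <= |a|]. *)
Lemma bell_step : c != 0 -> 4 * '[b] <= '[a] ->
  v (line_proj a) <> 0 -> v (line_proj (a + b)) <> 0.
Proof.
move=> c0 ba va vab; apply: (va).
have vb := measure_orth0 ab va; have vc := measure_orth0 ac va.
have cc0 : '[c] != 0 by rewrite dnorm_eq0.
pose r := sqrtC ('[a] / '[c]); pose d := sqrtC (('[a] - 4 * '[b]) / '[c]).
have r2 : r ^+ 2 = '[a] / '[c] := sqrtCK _.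
have d2 : d ^+ 2 = ('[a] - 4 * '[b]) / '[c] := sqrtCK _.
have r_real : r \is Num.real.
  by rewrite ger0_real // sqrtC_ge0 divr_ge0 ?dnorm_ge0.
have d_real : d \is Num.real.
  by rewrite ger0_real // sqrtC_ge0 divr_ge0 ?dnorm_ge0 ?subr_ge0.
pose s := (r + d) / 2; pose t := (r - d) / 2.
have t_real : t \is Num.real by rewrite rpredM ?rpredB ?rpredV ?realn.
have strE : s + t = r by rewrite /s /t; field.
have stb : s * t * '[c] = '[b].
  have -> : s * t = (r ^+ 2 - d ^+ 2) / 4 by rewrite /s /t; field.
  by rewrite r2 d2; field.
have vp := bell_span0 t_real stb vb vc vab.
have := @bell_span0 (- s) (- t); rewrite rpredN mulrNN -opprD scaleNr.
move=> /(_ t_real stb vb vc vab); move: vp; rewrite strE => vp vm.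
have := @measure_span0 _ _ 2^-1 2^-1 _ vp vm.
rewrite -scalerDr addrACA subrr addr0 -mulr2n -[a *+ 2]scaler_nat scalerA.
rewrite mulVf ?pnatr_eq0 // scale1r; apply.
have := dotE 1 0 r 1 0 (- r); rewrite !scale1r !scale0r !addr0 scaleNr => ->.
rewrite conjC0 conjC1 rmorphN /= (CrealP r_real) !mulr1 !mul0r addr0 mul1r.
by rewrite mulrN -expr2 mulNr r2 divfK // subrr.
Qed.
End bell.

(** The vectors [e1], [2 e1 + e2] and [e1 + e2] have successive angles of tangent
    1/2 and 1/3, small enough for [bell_step]. *)
Lemma measure_diagonal (e1 e2 e3 : 'rV[C]_n) :
  '[e1] = 1 -> '[e2] = 1 -> e3 != 0 ->
  '[e1, e2] = 0 -> '[e1, e3] = 0 -> '[e2, e3] = 0 ->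
  v (line_proj e1) <> 0 -> v (line_proj (e1 + e2)) <> 0.
Proof.
move=> e11 e22 e3_neq0 e12 e13 e23 ve1.
have e21 := dotmx_eq0C e12.
have dotE (i j i' j' : C) :
    '[i *: e1 + j *: e2, i' *: e1 + j' *: e2] = i * i'^* + j * j'^*.
  rewrite !(linearDl, linearDr) /= ![in LHS](linearZl_LR, linearZr_LR) /=.
  by rewrite e11 e12 e21 e22; ring.
have orth3 (i j : C) : '[i *: e1 + j *: e2, e3] = 0.
  by rewrite linearDl /= !linearZl_LR /= e13 e23; ring.
(* The null terms keep both vectors in the shape that [dotE] computes with. *)
have v2 : v (line_proj ((2 *: e1 + 0 *: e2) + (0 *: e1 + 1 *: e2))) <> 0.
  apply: (@bell_step _ _ e3); rewrite ?orth3 ?dotE ?conjC_nat ?conjC0 //.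
  - by ring.
  - by rewrite -subr_ge0 [X in 0 <= X](_ : _ = 0) //; ring.
  - rewrite scale0r addr0.
    by move/(measure_scale0 2^-1); rewrite scalerA mulVf ?pnatr_eq0 ?scale1r.
(* Up to the factors 3 and 5, this adds to [2 e1 + e2] its correction towards
   [e1 + e2] in the orthogonal direction [- e1 + 2 e2]. *)
have : v (line_proj ((6 *: e1 + 3 *: e2) + (- 1 *: e1 + 2 *: e2))) <> 0.
  apply: (@bell_step _ _ e3);
    rewrite ?orth3 ?dotE ?rmorphN ?conjC1 ?conjC_nat //.
  - by ring.
  - by rewrite -subr_ge0 [X in 0 <= X](_ : _ = 25) ?ler0n //; ring.
  - have -> : 6 *: e1 + 3 *: e2 =
        3 *: ((2 *: e1 + 0 *: e2) + (0 *: e1 + 1 *: e2)).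
      by apply/rowP => i; rewrite !mxE; ring.
    move/(measure_scale0 3^-1); rewrite scalerA mulVf ?pnatr_eq0 //.
    by rewrite [1 *: (_ + _)]scale1r.
have -> : 6 *: e1 + 3 *: e2 + (- 1 *: e1 + 2 *: e2) = 5 *: (e1 + e2).
  by apply/rowP => i; rewrite !mxE; ring.
by move=> v5 /(measure_scale0 5).
Qed.

Lemma measure_sum (I : eqType) (P : I -> 'M[C]_n) (r : seq I) :
  uniq r -> (forall i, projection (P i)) ->
  (forall i j, i != j -> P i *m P j = 0) ->
  projection (\sum_(i <- r) P i) /\
  v (\sum_(i <- r) P i) = \sum_(i <- r) v (P i).
Proof.
move=> + Pproj Porth; have [_ _ vD] := v_measure.
elim: r => [|i r IHr] /=.
  by rewrite !big_nil; split; [exact: projection0 | exact: measure0].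
case/andP=> ir /IHr[Sproj vS]; rewrite !big_cons.
have iS : P i *m \sum_(j <- r) P j = 0.
  rewrite mulmx_sumr big_seq big1 // => j jr.
  by apply: Porth; apply: contraNneq ir => ->.
by rewrite vD // vS; split=> //; exact: projectionD.
Qed.

(** The basis projections add up to the identity, which has value 1. *)
Lemma measure_basis : exists i : 'I_n, v (line_proj (delta_mx 0 i)) != 0.
Proof.
have [v1 _ _] := v_measure.
apply/existsP; apply: contra_eqT v1; rewrite negb_exists => /forallP vE.
have [] := @measure_sum _ (fun i => line_proj (delta_mx 0 i)) (index_enum 'I_n).
- exact: index_enum_uniq.
- by move=> i; exact: line_proj_projection.
- by move=> i j /negPf ij; apply: line_proj_mul0; rewrite dotmx_delta ij.
move=> _; under eq_bigr => i _ do rewrite line_proj_delta.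
rewrite -mx1_sum_delta big1 => [->|i _]; first by rewrite eq_sym oner_neq0.
by apply/eqP; rewrite -[_ == _]negbK vE.
Qed.

Theorem kochen_specker : (3 <= n)%N -> False.
Proof.
move=> n3; have [i /eqP vi] := measure_basis.
have [j] : exists j, j \in [set~ i]%SET.
  by apply/card_gt0P; rewrite cardsC1 card_ord; case: (n) n3 => [|[]].
rewrite !inE eq_sym => /negPf ij.
have [k] : exists k, k \in (~: [set i; j])%SET.
  apply/card_gt0P; rewrite cardsCs finset.setCK card_ord cards2 ij subn_gt0.
  exact: n3.
rewrite !inE negb_or ![k == _]eq_sym => /andP[/negPf ik /negPf jk].
have ek0 : (delta_mx 0 k : 'rV[C]_n) != 0.
  by rewrite -(dnorm_eq0 (@dotmx C n)) /= dotmx_delta eqxx oner_eq0.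
have vp : v (line_proj (delta_mx 0 i + delta_mx 0 j)) <> 0.
  by apply: (@measure_diagonal _ _ (delta_mx 0 k));
    rewrite ?dotmx_delta ?eqxx ?ij ?ik ?jk.
have : v (line_proj (delta_mx 0 i - delta_mx 0 j)) <> 0.
  by apply: (@measure_diagonal _ _ (delta_mx 0 k));
    rewrite ?hnormN ?linearNl ?linearNr /= ?dotmx_delta ?eqxx ?ij ?ik ?jk
            ?oppr0.
apply; apply: measure_orth0 vp.
by rewrite linearDl !linearBr /= !dotmx_delta !eqxx ij eq_sym ij; ring.
Qed.
End measure.
End two_valued_measures.

(** * Products of C*-algebras *)

(** A product has a base point and a uniform structure by unrelated instances;
    convergence in it is stated for the structure that joins the two. *)
HB.saturate prod.

Section prod_complete.
Local Open Scope classical_set_scope.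
Variables (K : numFieldType) (U V : completeNormedModType K).

Lemma prod_complete (F : set_system (U * V)) :
  ProperFilter F -> cauchy F -> cvg F.
Proof.
move=> FF Fc.
have /cauchy_cvg/cvg_ex[a Fa] : cauchy (fst @ F).
  move=> A entA; rewrite near_simpl -near2E near_map2.
  by apply: filterS (Fc _ (prod_entP entA entourageT)) => -[x y] [].
have /cauchy_cvg/cvg_ex[b Fb] : cauchy (snd @ F).
  move=> A entA; rewrite near_simpl -near2E near_map2.
  by apply: filterS (Fc _ (prod_entP entourageT entA)) => -[x y] [].
apply/cvg_ex; exists (a, b).
move=> A [[B D] [/= aB bD] BDA].
have FB : F (fst @^-1` B) := Fa _ aB.
have FD : F (snd @^-1` D) := Fb _ bD.
change (F A); apply: filterS (filterI FB FD) => -[x y] [xB yD].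
exact: (BDA (x, y)).
Qed.
End prod_complete.

HB.instance Definition _ (R : realType) (A B : cstarAlgType R) :=
  Uniform_isComplete.Build (A * B)%type (@prod_complete _ A B).

Section prod_cstar.
Variables (R : realType) (A B : cstarAlgType R).
Implicit Types x y : (A * B)%type.

Definition cprod_mul x y : A * B := (cmul x.1 y.1, cmul x.2 y.2).
Definition cprod_star x : A * B := (star x.1, star x.2).

Lemma cprod_mulA : associative cprod_mul.
Proof. by move=> x y z; rewrite /cprod_mul /= !cmulA. Qed.

Lemma cprod_mul1x : left_id (cone, cone) cprod_mul.
Proof. by case=> a b; rewrite /cprod_mul /= !cmul1x. Qed.

Lemma cprod_mulx1 : right_id (cone, cone) cprod_mul.
Proof. by case=> a b; rewrite /cprod_mul /= !cmulx1. Qed.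

Lemma cprod_mulDl : left_distributive cprod_mul +%R.
Proof. by move=> x y z; rewrite /cprod_mul /= !cmulDl. Qed.

Lemma cprod_mulDr : right_distributive cprod_mul +%R.
Proof. by move=> x y z; rewrite /cprod_mul /= !cmulDr. Qed.

Lemma cprod_scalerAl (k : R[i]) x y : k *: cprod_mul x y = cprod_mul (k *: x) y.
Proof. by rewrite /cprod_mul /= -!cscalerAl. Qed.

Lemma cprod_scalerAr (k : R[i]) x y : k *: cprod_mul x y = cprod_mul x (k *: y).
Proof. by rewrite /cprod_mul /= -!cscalerAr. Qed.

Lemma cprod_starK : involutive cprod_star.
Proof. by case=> a b; rewrite /cprod_star /= !starK. Qed.

Lemma cprod_starD : {morph cprod_star : x y / x + y}.
Proof. by move=> x y; rewrite /cprod_star /= !starD. Qed.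

Lemma cprod_starZ (k : R[i]) x : cprod_star (k *: x) = k^* *: cprod_star x.
Proof. by rewrite /cprod_star /= !starZ. Qed.

Lemma cprod_starM x y :
  cprod_star (cprod_mul x y) = cprod_mul (cprod_star y) (cprod_star x).
Proof. by rewrite /cprod_star /= !starM. Qed.

Lemma cprod_norm_le x (r : R[i]) :
  (`|x| <= r) = (`|x.1| <= r) && (`|x.2| <= r).
Proof. by rewrite prod_normE comparable_ge_max // real_comparable. Qed.

Lemma cprod_normM x y : `|cprod_mul x y| <= `|x| * `|y|.
Proof.
have := lexx `|x|; have := lexx `|y|.
rewrite cprod_norm_le => /andP[y1 y2]; rewrite cprod_norm_le => /andP[x1 x2].
rewrite cprod_norm_le /=.
by rewrite !(le_trans (cnormM _ _)) ?ler_pM.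
Qed.

Lemma cprod_norm_star x : `|cprod_mul (cprod_star x) x| = `|x| ^+ 2.
Proof.
rewrite !prod_normE /= !cnorm_star.
have [h|h] := real_leP (normr_real x.1) (normr_real x.2).
  by rewrite max_r // ler_pXn2r ?nnegrE.
by rewrite max_l // ler_pXn2r ?nnegrE // ltW.
Qed.

HB.instance Definition _ := @isCStarAlgebra.Build R (A * B)%type
  (cone, cone) cprod_mul cprod_star
  cprod_mulA cprod_mul1x cprod_mulx1 cprod_mulDl cprod_mulDr
  cprod_scalerAl cprod_scalerAr
  cprod_starK cprod_starD cprod_starZ cprod_starM
  cprod_normM cprod_norm_star.
End prod_cstar.

Section prod_hom.
Variables (R : realType) (A B D : cstarAlgType R).

Program Definition starHom_fst : starHom (A * B)%type A :=
  @StarHom R (A * B)%type A fst _ _ _ _.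
Next Obligation. by []. Qed.
Next Obligation. by []. Qed.
Next Obligation. by []. Qed.
Next Obligation. by []. Qed.

Program Definition starHom_snd : starHom (A * B)%type B :=
  @StarHom R (A * B)%type B snd _ _ _ _.
Next Obligation. by []. Qed.
Next Obligation. by []. Qed.
Next Obligation. by []. Qed.
Next Obligation. by []. Qed.

Program Definition starHom_pair (f : starHom D A) (g : starHom D B) :
    starHom D (A * B)%type :=
  @StarHom R D (A * B)%type (fun x => (f x, g x)) _ _ _ _.
Next Obligation. by move=> f g k x y; rewrite /= !starHom_linear. Qed.
Next Obligation. by move=> f g; rewrite /= !starHom1. Qed.
Next Obligation. by move=> f g x y; rewrite /= !starHomM. Qed.
Next Obligation. by move=> f g x; rewrite /= !starHom_star. Qed.

Lemma prod_commutative : is_commutative A -> is_commutative B ->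
  @is_commutative R (A * B)%type.
Proof. by move=> cA cB x y; congr pair; [exact: cA | exact: cB]. Qed.
End prod_hom.

(** * Orthogonal projections as *-homomorphisms from C^3 *)

Section cube.
Variable R : realType.
Local Notation C := R[i].

Definition cube : cstarAlgType R :=
  ((complexes R * complexes R) * complexes R)%type.

Lemma cube_commutative : @is_commutative R cube.
Proof. by do 2?apply: prod_commutative; exact: mulrC. Qed.

Definition coord1 : starHom cube (complexes R) :=
  starHom_comp (starHom_fst _ _) (starHom_fst _ _).
Definition coord2 : starHom cube (complexes R) :=
  starHom_comp (starHom_snd _ _) (starHom_fst _ _).
Definition coord3 : starHom cube (complexes R) := starHom_snd _ _.
Definition reindex (f g h : starHom cube (complexes R)) : starHom cube cube :=
  starHom_pair (starHom_pair f g) h.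

Variable n : nat.
Implicit Types p q : 'M[C]_n.

Definition orth_projections p q :=
  [/\ projection p, projection q & p *m q = 0].

Lemma orth_projections0 p : projection p -> orth_projections p 0.
Proof. by move=> pP; split; [|exact: projection0|exact: mulmx0]. Qed.

Definition spectral_fun p q (x : cube) : cmatrix R n :=
  (x.1.1 : C) *: p + (x.1.2 : C) *: q + (x.2 : C) *: (1%:M - (p + q)).

Section spectral_hom.
Variables p q : 'M[C]_n.
Hypothesis pqP : orth_projections p q.

Fact spectral_linear : linear (spectral_fun p q).
Proof.
move=> k x y; apply/matrixP => i j; rewrite /spectral_fun !mxE /=.
have E (a b : complexes R) : k *: a + b = (k * a + b : C) by [].
by rewrite !E; ring.
Qed.

Fact spectral_1 : spectral_fun p q cone = cone.
Proof. by rewrite /spectral_fun /= !scale1r subrKC. Qed.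

Fact spectral_M : {morph spectral_fun p q : x y / cmul x y}.
Proof.
case: pqP => pP qP pq0; have qp0 := projection_mul0C pP qP pq0.
have [rr _] :=
  projectionB (projection1 _ _) (projectionD pP qP pq0) (mulmx1 _).
move=> x y; rewrite /spectral_fun /= /cmul /=.
move: rr; set r := 1%:M - (p + q) => rr.
have pr : p *m r = 0 by rewrite mulmxBr mulmx1 mulmxDr pP.1 pq0 addr0 subrr.
have qr : q *m r = 0 by rewrite mulmxBr mulmx1 mulmxDr qP.1 qp0 add0r subrr.
have rp : r *m p = 0 by rewrite mulmxBl mul1mx mulmxDl pP.1 qp0 addr0 subrr.
have rq : r *m q = 0 by rewrite mulmxBl mul1mx mulmxDl qP.1 pq0 add0r subrr.
rewrite !mulmxDl !mulmxDr -!scalemxAl -!scalemxAr.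
rewrite pP.1 qP.1 rr pq0 qp0 pr qr rp rq.
by rewrite !scaler0 !addr0 !add0r !scalerA.
Qed.

Fact spectral_star : {morph spectral_fun p q : x / star x}.
Proof.
case: pqP => pP qP pq0.
have [_ rs] :=
  projectionB (projection1 _ _) (projectionD pP qP pq0) (mulmx1 _).
move=> x; rewrite /spectral_fun /star /= !adjointD !adjointZ.
congr (_ *: _ + _ *: _ + _ *: _).
- exact/esym/pP.2.
- exact/esym/qP.2.
- exact/esym/rs.
Qed.

Definition spectral_hom : starHom cube (cmatrix R n) :=
  StarHom spectral_linear spectral_1 spectral_M spectral_star.
End spectral_hom.
End cube.

(** * The measure defined by a point *)

Section point.
Variables (R : realType) (G : functor (op (Cstar R)) Top).
Local Notation GC :=
  (comp_functor G (op_functor (inclusion (@is_commutative R)))).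
Variable eta : forall A : op (cCstar R), @arrow Top (GC A) (Spec R A).
Hypothesis eta_natural : forall (A A' : op (cCstar R)) (h : arrow A A'),
  compc (eta A') (Defs.fmap GC h) = compc (Defs.fmap (Spec R) h) (eta A).

Section characters_of_point.
Variables (B : Cstar R) (x : (G B : topologicalType)).

(** The functor [G] is contravariant on algebras: [f] pulls the point [x] of [G B]
    back to [G A], and [eta] reads the result as a character. *)
Definition chi (A : cCstar R) (f : starHom (sval A) B) :
    starHom (sval A) (complexes R) :=
  eta A (@Defs.fmap _ _ G B (sval A) f x).

(** Functoriality of [G] splits off [h], and naturality of [eta] turns it into the
    precomposition by [h] of a character. *)
Lemma chi_comp (A A' : cCstar R) (h : starHom (sval A') (sval A))
    (f : starHom (sval A) B) a :
  @chi A' (starHom_comp f h) a = @chi A f (h a).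
Proof.
pose y := @Defs.fmap _ _ G B (sval A) f x.
have Gfh := congr1 (fun k : continuousType (G B) (G (sval A')) => k x)
  (@Defs.fmapM _ _ G B (sval A) (sval A') h f).
transitivity ((eta A' (@Defs.fmap _ _ G (sval A) (sval A') h y)
               : starHom (sval A') (complexes R)) a).
  by congr ((_ : starHom (sval A') (complexes R)) a); congr (eta A' _).
exact: (congr1
  (fun k : continuousType (G (sval A)) (characters (sval A')) =>
     (k y : starHom (sval A') (complexes R)) a) (@eta_natural A A' h)).
Qed.
End characters_of_point.

Section measure_of_point.
Variable n : nat.
Local Notation C := R[i].
Local Notation M := (cmatrix R n).
Variable x : (G M : topologicalType).
Implicit Types p q : 'M[C]_n.

Let cubeC : cCstar R := exist _ (cube R) (@cube_commutative R).
Let mu p q (pqP : orth_projections p q) : starHom (cube R) (complexes R) :=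
  @chi M x cubeC (spectral_hom pqP).

(** An endomorphism of [cube] that turns one *-homomorphism into another is what
    allows to compare the characters on different commutative subalgebras. *)
Let mu_reindex p q p' q' (pqP : orth_projections p q)
    (pqP' : orth_projections p' q') (h : starHom (cube R) (cube R)) a :
  (forall y, spectral_fun p' q' y = spectral_fun p q (h y)) ->
  mu pqP' a = mu pqP (h a).
Proof.
move=> E; rewrite /mu.
have -> : spectral_hom pqP' = starHom_comp (spectral_hom pqP) h :> starHom _ _.
  exact/starHomP/E.
exact: (@chi_comp M x cubeC cubeC).
Qed.

(** The pair [p, 0] stands for the commutative subalgebra generated by [p] alone;
    its *-homomorphism ignores the second coordinate. *)
Definition point_measure p : C :=
  if pselect (projection p) is left pP
  then mu (orth_projections0 pP) ((1, 0), 0) else 0.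

Let point_measureE p (pP : projection p) :
  point_measure p = mu (orth_projections0 pP) ((1, 0), 0).
Proof.
rewrite /point_measure; case: pselect => // pP'.
by congr (mu (orth_projections0 _) _); exact: Prop_irrelevance.
Qed.

(** The *-homomorphisms for [p], [q] and [p + q] factor through the one for the
    pair [p, q], by repeating coordinates. *)
Let point_measure_pair p q (pqP : orth_projections p q) :
  [/\ point_measure p = mu pqP ((1, 0), 0),
      point_measure q = mu pqP ((0, 1), 0) &
      point_measure (p + q) = mu pqP ((1, 1), 0)].
Proof.
case: (pqP) => pP qP pq0; split.
- rewrite (point_measureE pP).
  apply: (@mu_reindex _ _ _ _ _ _ (reindex (coord1 R) (coord3 R) (coord3 R))).
  move=> y; rewrite /spectral_fun /=.
  by apply/matrixP => i j; rewrite !mxE; ring.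
- rewrite (point_measureE qP).
  apply: (@mu_reindex _ _ _ _ _ _ (reindex (coord3 R) (coord1 R) (coord3 R))).
  move=> y; rewrite /spectral_fun /=.
  by apply/matrixP => i j; rewrite !mxE; ring.
- rewrite (point_measureE (projectionD pP qP pq0)).
  apply: (@mu_reindex _ _ _ _ _ _ (reindex (coord1 R) (coord1 R) (coord3 R))).
  move=> y; rewrite /spectral_fun /=.
  by apply/matrixP => i j; rewrite !mxE; ring.
Qed.

Lemma point_measure_two_valued : two_valued_measure point_measure.
Proof.
split.
- rewrite (point_measureE (projection1 _ n)).
  set P := orth_projections0 _; rewrite -[RHS](starHom1 (mu P)).
  (* For [p = 1] only the first coordinate counts, so that [(1, 0, 0)] and the
     unit [(1, 1, 1)] have the same value. *)
  apply: (@mu_reindex _ _ _ _ P P (reindex (coord1 R) (coord1 R) (coord1 R))).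
  move=> y; rewrite /spectral_fun /=.
  by apply/matrixP => i j; rewrite !mxE; ring.
- move=> p pP; rewrite (point_measureE pP).
  set m := mu _; set e : cube R := ((1, 0), 0).
  have ee : cmul e e = e.
    by rewrite [LHS](_ : _ = (1 * 1 : C, 0 * 0 : C, 0 * 0 : C)) // !mulr0 mulr1.
  have := starHomM m e e; rewrite ee; set z : C := m e => zz.
  have /eqP : z * (z - 1) = 0 by rewrite mulrBr mulr1 -[z * z]zz subrr.
  by rewrite mulf_eq0 subr_eq0 => /orP[] /eqP; [left|right].
- move=> p q pP qP pq0.
  have pqP : orth_projections p q by split.
  have [-> -> ->] := point_measure_pair pqP.
  have := starHom_linear (mu pqP) 1 ((1, 0), 0) ((0, 1), 0).
  have <- : ((1, 1), 0) = 1 *: ((1, 0), 0) + ((0, 1), 0) :> cube R.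
    rewrite scale1r [RHS](_ : _ = (1 + 0 : C, 0 + 1 : C, 0 + 0 : C)) //.
    by rewrite !addr0 add0r.
  by move=> ->; rewrite scale1r.
Qed.
End measure_of_point.
End point.

Theorem corollary5p3 (R : realType) (n : nat) (n_ge3 : (3 <= n)%N)
  (G : functor (op (Cstar R)) Top)
  (G_Spec : naturally_isomorphic
     (comp_functor G (op_functor (inclusion (@is_commutative R)))) (Spec R)) :
  @is_initial Top (G (cmatrix R n)) /\
  ((G (cmatrix R n) : topologicalType) -> False).
Proof.
have G_empty : (G (cmatrix R n) : topologicalType) -> False.
  case: G_Spec => eta [_ eta_natural] x.
  exact: (kochen_specker (point_measure_two_valued eta_natural x) n_ge3).
split=> // Y.
pose f (x : (G (cmatrix R n) : topologicalType)) : (Y : topologicalType) :=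
  False_rect _ (G_empty x).
have f_continuous : continuous f by move=> x; case: (G_empty x).
pose F : continuousType (G (cmatrix R n)) Y := mkcts f_continuous.
by exists F => g; apply/continuousEP => x; case: (G_empty x).
Qed.
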